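(* Let $n,m\ge 1$. Let $\bar{\mu},\mu_O\in\mathbb{R}^n$, $z,\hat z\in\mathbb{R}^m$, $H\in\mathbb{R}^{m\times n}$, and let $\bar\Sigma,\Sigma_O\in\mathbb{R}^{n\times n}$ and $Q\in\mathbb{R}^{m\times m}$ be symmetric positive definite. For $x\in\mathbb{R}^n$ define $$\mathcal{J}(x)=\tfrac12\big(z-\hat z-H(x-\bar\mu)\big)^TQ^{-1}\big(z-\hat z-H(x-\bar\mu)\big)+\tfrac12(x-\mu_O)^T\Sigma_O^{-1}(x-\mu_O)+\tfrac12(x-\bar\mu)^T\bar\Sigma^{-1}(x-\bar\mu).$$ Then the probability density on $\mathbb{R}^n$ proportional to $\exp(-\mathcal{J}(x))$ is the Gaussian density $\mathcal{N}(\mu,\Sigma)$ with $$\Sigma=\left(H^TQ^{-1}H+\Sigma_O^{-1}+\bar\Sigma^{-1}\right)^{-1},\qquad \mu=\bar\mu+K(z-\hat z)+\Sigma\,\Sigma_O^{-1}(\mu_O-\bar\mu),$$ where $K=\Sigma H^TQ^{-1}$. Moreover, $$K=\bar\Sigma(\bar\Sigma+\Sigma_O)^{-1}\Sigma_O H^T\left(H\bar\Sigma(\bar\Sigma+\Sigma_O)^{-1}\Sigma_O H^T+Q\right)^{-1}$$ and $$\Sigma=(I-KH)\,\bar\Sigma(\bar\Sigma+\Sigma_O)^{-1}\Sigma_O .$$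
   Context: This is the measurement update of an extended Kalman filter with uncertain object (landmark) location. Here $\mathcal{N}(\bar\mu,\bar\Sigma)$ is the predicted belief of the robot state $x$, $z$ is the measurement, $\hat z=h(\bar\mu)$ is the predicted measurement for the observation function $h$ linearised at $\bar\mu$ with Jacobian $H$, $Q$ is the measurement noise covariance, and $\mathcal{N}(\mu_O,\Sigma_O)$ is the Gaussian model, as a function of $x$, for the probability of observing the object from $x$. The posterior belief is the normalised product of the linearised measurement likelihood, the object term and the predicted belief, that is, the density proportional to $\exp(-\mathcal{J}(x))$. $I$ denotes the $n\times n$ identity matrix. *)

(* Defs.v *)
From HB Require Import structures.
From mathcomp Require Import all_boot all_order all_algebra.
From mathcomp Require Import all_classical all_reals all_analysis.

Set Implicit Arguments.
Unset Strict Implicit.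
Unset Printing Implicit Defensive.

Import Order.TTheory GRing.Theory Num.Theory numFieldNormedType.Exports.
Local Open Scope classical_set_scope.
Local Open Scope ring_scope.

Definition qform (R : realType) (n : nat) (A : 'M[R]_n) (v : 'cV[R]_n) : R :=
  (v^T *m A *m v) ord0 ord0.

Definition posdefmx (R : realType) (n : nat) (A : 'M[R]_n) : Prop :=
  A \is symmetricmx /\ forall v : 'cV[R]_n, v != 0 -> 0 < qform A v.

(* Lebesgue measure on R^n. The carrier is [n.-tuple], on which the library
   puts the sigma-algebra generated by the coordinates; the measure is built by
   iterated binary products, and [lebesgue_tuple_box] gives its value on boxes.
   [lebesgue_tuple 0] is the unit mass at the empty tuple. *)
Section lebesgue_tuple.
Variable R : realType.

Definition cons_pair (n : nat)
    (p : measurableTypeR R * n.-tuple (measurableTypeR R)) :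
    n.+1.-tuple (measurableTypeR R) :=
  [the n.+1.-tuple _ of p.1 :: p.2].

Lemma measurable_cons_pair (n : nat) : measurable_fun setT (@cons_pair n).
Proof. exact: measurable_cons. Qed.

Section lebesgue_cons.
Variable n : nat.
Variable mu : {sigma_finite_measure set (n.-tuple (measurableTypeR R)) -> \bar R}.

Definition lebesgue_cons : set (n.+1.-tuple (measurableTypeR R)) -> \bar R :=
  pushforward (lebesgue_measure \x mu)%E (@cons_pair n).

Let nu : {measure set (n.+1.-tuple (measurableTypeR R)) -> \bar R} :=
  measure_function_pushforward__canonical__measure_function_Measure
    (lebesgue_measure \x mu)%E (@measurable_cons_pair n).

Let lebesgue_cons0 : lebesgue_cons set0 = 0%E.
Proof. exact: (measure0 nu). Qed.

Let lebesgue_cons_ge0 A : (0 <= lebesgue_cons A)%E.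
Proof. exact: (measure_ge0 nu). Qed.

Let lebesgue_cons_sigma_additive : semi_sigma_additive lebesgue_cons.
Proof. exact: (@measure_semi_sigma_additive _ _ _ nu). Qed.

HB.instance Definition _ := isMeasure.Build _ _ _ lebesgue_cons
  lebesgue_cons0 lebesgue_cons_ge0 lebesgue_cons_sigma_additive.

Let lebesgue_cons_sigma_finite : sigma_finite setT lebesgue_cons.
Proof.
have /sigma_finiteP[F [FT ndF mF]] := sigma_finiteT (@lebesgue_measure R).
have /sigma_finiteP[G [GT ndG mG]] := sigma_finiteT mu.
pose g (t : n.+1.-tuple (measurableTypeR R)) :
    measurableTypeR R * n.-tuple (measurableTypeR R) :=
  (tnth t ord0, [tuple of behead t]).
have mg : measurable_fun setT g.
  apply/measurable_fun_pairP.
  by split; [exact: measurable_tnth|exact: measurable_behead].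
exists (fun k => g @^-1` (F k `*` G k)).
  apply/seteqP; split => // t _.
  have [i _ Fi] : (\bigcup_i F i) (g t).1 by rewrite -FT.
  have [j _ Gj] : (\bigcup_j G j) (g t).2 by rewrite -GT.
  exists (maxn i j) => //; split.
  - by move: Fi; exact/subsetPset/ndF/leq_maxl.
  - by move: Gj; exact/subsetPset/ndG/leq_maxr.
move=> k; have [mFk Fk] := mF k; have [mGk Gk] := mG k; split.
  by rewrite -[X in measurable X]setTI; apply: mg => //; exact: measurableX.
rewrite /lebesgue_cons /pushforward -comp_preimage.
have -> : g \o @cons_pair n = id.
  apply/funext => -[x t] /=; rewrite /g /cons_pair/= (tnth_nth x)/=.
  by congr pair; exact/val_inj.
by rewrite preimage_id product_measure1E// lte_mul_pinfty// ge0_fin_numE.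
Qed.

HB.instance Definition _ :=
  @Measure_isSigmaFinite.Build _ _ _ lebesgue_cons lebesgue_cons_sigma_finite.

End lebesgue_cons.

Fixpoint lebesgue_tuple (n : nat) :
    {sigma_finite_measure set (n.-tuple (measurableTypeR R)) -> \bar R} :=
  if n is n'.+1 return
    {sigma_finite_measure set (n.-tuple (measurableTypeR R)) -> \bar R}
  then lebesgue_cons (lebesgue_tuple n')
  else \d_ ([tuple] : 0.-tuple (measurableTypeR R)).

Lemma measurable_box (n : nat) (A : 'I_n -> set (measurableTypeR R)) :
  (forall i, measurable (A i)) ->
  measurable [set t : n.-tuple (measurableTypeR R) | forall i, A i (tnth t i)].
Proof.
move=> mA.
rewrite (_ : [set t | _] =
  \bigcap_(i in [set: 'I_n]) ((@tnth n _)^~ i @^-1` A i)).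
  apply: fin_bigcap_measurable => // i _.
  by rewrite -[X in measurable X]setTI; exact: measurable_tnth.
by apply/seteqP; split => t /= h i => [_|]; exact: h.
Qed.

Lemma lebesgue_tuple_box (n : nat) (A : 'I_n -> set (measurableTypeR R)) :
  (forall i, measurable (A i)) ->
  lebesgue_tuple n [set t | forall i, A i (tnth t i)] =
  (\prod_(i < n) lebesgue_measure (A i))%E.
Proof.
elim: n A => [|n IH] A mA.
  by rewrite big_ord0 /= diracE mem_set//= => -[].
rewrite big_ord_recl -IH// -product_measure1E//=; last first.
  by apply: (@measurable_box _ (fun i => A (lift ord0 i))) => i; exact: mA.
rewrite /lebesgue_cons /pushforward; congr (_ _).
apply/seteqP; split => -[x t] /=.
  move=> h; split; first exact: (h ord0).
  by move=> i; have := h (lift ord0 i); rewrite tnthS.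
move=> [hx ht] i; case: (unliftP ord0 i) => [j ->|->//].
by rewrite tnthS.
Qed.

End lebesgue_tuple.

Definition col_of_tuple (R : realType) (n : nat)
    (t : n.-tuple (measurableTypeR R)) : 'cV[R]_n := \col_i tnth t i.

Definition is_pdf (R : realType) (n : nat) (p : 'cV[R]_n -> R) : Prop :=
  [/\ measurable_fun [set: n.-tuple (measurableTypeR R)]
        (fun t => p (col_of_tuple t)),
      (forall x, 0 <= p x) &
      (\int[lebesgue_tuple R n]_(t in setT) (p (col_of_tuple t))%:E)%E = 1%E].

Definition proportional (R : realType) (T : Type) (p f : T -> R) : Prop :=
  exists c : R, forall x, p x = c * f x.

(* The density of N(mu, Sigma); meaningful when [posdefmx Sigma]. *)
Definition gaussian_pdf (R : realType) (n : nat) (mu : 'cV[R]_n)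
    (Sigma : 'M[R]_n) (x : 'cV[R]_n) : R :=
  (Num.sqrt ((2 * pi) ^+ n * \det Sigma))^-1 *
  expR (- (2^-1 * qform (invmx Sigma) (x - mu))).

Definition ekf_cost (R : realType) (n m : nat) (mubar muO : 'cV[R]_n)
    (z zhat : 'cV[R]_m) (H : 'M[R]_(m, n)) (Sbar SO : 'M[R]_n) (Q : 'M[R]_m)
    (x : 'cV[R]_n) : R :=
  2^-1 * qform (invmx Q) (z - zhat - H *m (x - mubar))
  + 2^-1 * qform (invmx SO) (x - muO)
  + 2^-1 * qform (invmx Sbar) (x - mubar).

(* Main.v *)
(* Both [-J] and the exponent of N(mu, Sigma) are quadratic in x with the same
   second order part, and mu is chosen so that the gradient of J vanishes there;
   hence exp(-J) is a constant multiple of the Gaussian density, and the constant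
   is forced by normalization. That the Gaussian density has total mass 1 is shown
   by induction on the dimension: the Schur complement splits the quadratic form
   into one in the first coordinate and one in the others whose centre depends
   affinely on the first, so Fubini-Tonelli reduces to the scalar case.
   The two gain formulas follow from K H P = Sigma (Sigma^-1 - P^-1) P = P - Sigma,
   where P = Sbar (Sbar + SO)^-1 SO is the inverse of SO^-1 + Sbar^-1. *)
Require Import Defs.
From mathcomp Require Import all_boot all_order all_algebra.
From mathcomp Require Import all_classical all_reals all_analysis.
From mathcomp Require Import measurable_realfun ring lra.
Import Order.TTheory GRing.Theory Num.Theory numFieldNormedType.Exports.
Local Open Scope classical_set_scope.
Local Open Scope ring_scope.

(** * Quadratic forms and positive definite matrices *)

Lemma symmetricmxP (R : realType) (n : nat) (A : 'M[R]_n) :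
  reflect (A^T = A) (A \is symmetricmx).
Proof.
rewrite is_hermitianmxE expr0 scale1r map_mx_id//.
by apply: (iffP eqP) => [{2}->|->].
Qed.

Lemma trmx_eq11 (R : realType) (A : 'M[R]_1) : A^T ord0 ord0 = A ord0 ord0.
Proof. by rewrite mxE. Qed.

Lemma mx11D (R : realType) (A B : 'M[R]_1) :
  (A + B) ord0 ord0 = A ord0 ord0 + B ord0 ord0.
Proof. by rewrite mxE. Qed.

Lemma qform0 (R : realType) (n : nat) (A : 'M[R]_n) : qform A 0 = 0.
Proof. by rewrite /qform mulmx0 mxE. Qed.

Lemma qformN (R : realType) (n : nat) (A : 'M[R]_n) v : qform A (- v) = qform A v.
Proof. by rewrite /qform mulmxN linearN/= !mulNmx opprK. Qed.

Lemma qformDl (R : realType) (n : nat) (A B : 'M[R]_n) v :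
  qform (A + B) v = qform A v + qform B v.
Proof. by rewrite /qform mulmxDr mulmxDl mxE. Qed.

Lemma qform_congr (R : realType) (n m : nat) (A : 'M[R]_m) (H : 'M[R]_(m, n)) v :
  qform (H^T *m A *m H) v = qform A (H *m v).
Proof. by rewrite /qform trmx_mul !mulmxA. Qed.

Lemma qformD (R : realType) (n : nat) (A : 'M[R]_n) u v : A^T = A ->
  qform A (u + v) = qform A u + 2 * (u^T *m A *m v) ord0 ord0 + qform A v.
Proof.
move=> As; rewrite /qform !linearD /= !mulmxDl !mx11D.
have -> : (v^T *m A *m u) ord0 ord0 = (u^T *m A *m v) ord0 ord0.
  by rewrite -trmx_eq11 !trmx_mul trmxK As mulmxA.
ring.
Qed.

Lemma posdefmx_sym (R : realType) (n : nat) (A : 'M[R]_n) :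
  posdefmx A -> A^T = A.
Proof. by case=> /symmetricmxP. Qed.

Lemma qform_ge0 (R : realType) (n : nat) (A : 'M[R]_n) v :
  posdefmx A -> 0 <= qform A v.
Proof.
case=> _ Ap; have [->|/Ap/ltW//] := eqVneq v 0.
by rewrite qform0.
Qed.

(** A nonzero row vector in the left kernel would make the quadratic form vanish at its
    transpose. *)
Lemma posdefmx_unit (R : realType) (n : nat) (A : 'M[R]_n) :
  posdefmx A -> A \in unitmx.
Proof.
move=> [As Ap]; rewrite -row_free_unit -kermx_eq0.
apply/rowV0P => w /sub_kermxP wA0; apply/eqP/contraT => w0.
have := Ap w^T; rewrite /qform trmxK wA0 mul0mx mxE ltxx.
by move=> h; apply: h; rewrite trmx_eq0.
Qed.

Lemma posdefmx_inv (R : realType) (n : nat) (A : 'M[R]_n) :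
  posdefmx A -> posdefmx (invmx A).
Proof.
move=> Apd; have Au := posdefmx_unit _ _ _ Apd; have As := posdefmx_sym _ _ _ Apd.
have Ais : (invmx A)^T = invmx A by rewrite trmx_inv As.
split; first exact/symmetricmxP.
(* By symmetry the inverse is congruent to [A] itself, so its form at [v] is the form of [A] at
   [invmx A *m v]. *)
move=> v v0; have -> : invmx A = (invmx A)^T *m A *m invmx A.
  by rewrite Ais mulVmx// mul1mx.
rewrite qform_congr; apply: (proj2 Apd); apply: contraNneq v0 => h.
by rewrite -(mulKVmx Au v) h mulmx0.
Qed.

Lemma posdefmxD (R : realType) (n : nat) (A B : 'M[R]_n) :
  posdefmx A -> posdefmx B -> posdefmx (A + B).
Proof.
move=> Ap Bp; split.
  by apply/symmetricmxP; rewrite linearD/= !posdefmx_sym.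
by move=> v v0; rewrite qformDl addr_gt0//; [apply Ap|apply Bp].
Qed.

Lemma posdefmxD_congr (R : realType) (n m : nat) (A : 'M[R]_n) (B : 'M[R]_m)
    (H : 'M[R]_(m, n)) :
  posdefmx A -> posdefmx B -> posdefmx (H^T *m B *m H + A).
Proof.
move=> Ap Bp; split.
  by apply/symmetricmxP; rewrite linearD/= !trmx_mul trmxK mulmxA !posdefmx_sym.
move=> v v0; rewrite qformDl qform_congr ltr_wpDl//; first exact: qform_ge0.
exact: (proj2 Ap).
Qed.

(** Completing the square in the second block: [D] is the lower right block of [A], [S] its Schur
    complement, and [- (g *m s)] the point at which the form is minimal in [t] for fixed [s]. *)
Lemma posdefmx_schur (R : realType) (n1 n2 : nat) (A : 'M[R]_(n1 + n2)) :
  posdefmx A -> exists S D (g : 'M[R]_(n2, n1)),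
  [/\ posdefmx S, posdefmx D, \det A = \det S * \det D &
      forall s t, qform A (col_mx s t) = qform S s + qform D (t + g *m s)].
Proof.
move=> Apd; have As := posdefmx_sym _ _ _ Apd.
set D := drsubmx A; set b := dlsubmx A.
have urE : ursubmx A = b^T by rewrite /b trmx_dlsub As.
have AE : A = block_mx (ulsubmx A) b^T b D by rewrite -urE submxK.
have DE t : qform A (col_mx 0 t) = qform D t.
  rewrite /qform {1}AE tr_col_mx mul_row_block mul_row_col.
  by rewrite trmx0 !mul0mx mulmx0 !add0r.
have Dpd : posdefmx D.
  split; first by apply/symmetricmxP; rewrite /D trmx_drsub As.
  move=> v v0; rewrite -DE; apply: (proj2 Apd).
  by rewrite col_mx_eq0 negb_and v0 orbT.
have Du := posdefmx_unit _ _ _ Dpd; have Ds := posdefmx_sym _ _ _ Dpd.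
pose g := invmx D *m b.
pose S := ulsubmx A - b^T *m g.
have gtD : g^T *m D = b^T by rewrite trmx_mul trmx_inv Ds mulmxKV.
(* Block LDL factorization; the shear has determinant 1, which also yields the formula for
   [\det A]. *)
have AW : A = (block_mx 1%:M 0 g 1%:M)^T *m block_mx S 0 0 D *m
              block_mx 1%:M 0 g 1%:M.
  rewrite tr_block_mx !mulmx_block !trmx1 trmx0.
  rewrite !(mul1mx, mulmx1, mulmx0, mul0mx, addr0, add0r) gtD subrK.
  by rewrite /g mulKVmx// -AE.
have qE s t : qform A (col_mx s t) = qform S s + qform D (t + g *m s).
  rewrite AW qform_congr mul_block_col !mul1mx mul0mx addr0 [g *m s + t]addrC.
  rewrite /qform tr_col_mx mul_row_block mul_row_col.
  by rewrite !mulmx0 addr0 add0r mxE.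
exists S, D, g; split=> //.
- split.
    apply/symmetricmxP; rewrite /S linearB/= !trmx_mul trmxK trmx_inv Ds mulmxA.
    by rewrite trmx_ulsub As.
  (* This second block cancels the [D] term, so [S] inherits positivity from [A]. *)
  move=> v v0; have := qE v (- (g *m v)).
  rewrite addNr qform0 addr0 => <-; apply: (proj2 Apd).
  by rewrite col_mx_eq0 negb_and v0.
- by rewrite {1}AW !det_mulmx det_tr det_lblock !det1 det_ublock !mul1r mulr1.
Qed.

(** * Gaussian integrals *)

Lemma measurable_gaussian_exp (R : realType) (d : measure_display)
    (T : measurableType d) (n : nat) (A : 'M[R]_n) (u : T -> 'cV[R]_n) :
  (forall i, measurable_fun setT (fun t => u t i ord0)) ->
  measurable_fun setT (fun t => expR (- (2^-1 * qform A (u t)))).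
Proof.
move=> mu; apply: measurableT_comp => //; apply: measurableT_comp => //.
apply: measurable_funM => //; rewrite /qform.
under eq_fun do rewrite mxE.
apply: measurable_sum => i; apply: measurable_funM => //.
under eq_fun do rewrite mxE.
apply: measurable_sum => j; apply: measurable_funM => //.
under eq_fun do rewrite mxE.
exact: mu.
Qed.

Lemma measurable_col_of_tupleB (R : realType) (n : nat) (c : 'cV[R]_n) i :
  measurable_fun [set: n.-tuple (measurableTypeR R)]
    (fun t => (col_of_tuple t - c) i ord0).
Proof.
under eq_fun do rewrite !mxE.
by apply: measurable_funB => //; exact: measurable_tnth.
Qed.

Lemma integral_normal_fun (R : realType) (m s : R) : s != 0 ->
  (\int[lebesgue_measure]_x (normal_fun m s x)%:E = (normal_peak s)^-1%:E)%E.
Proof.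
move=> s0; have p0 := normal_peak_gt0 s0.
under eq_integral => x _.
  rewrite (_ : normal_fun m s x = (normal_peak s)^-1 * normal_pdf m s x); last first.
    by rewrite normal_pdfE// mulKf// gt_eqF.
  rewrite EFinM.
  over.
rewrite integralZl//; last exact: integrable_normal_pdf.
by rewrite integral_normal_pdf mule1.
Qed.

Lemma integral_gaussian_exp1 (R : realType) (S : 'M[R]_1) (c : 'cV[R]_1) :
  posdefmx S -> 0 < \det S /\
  (\int[lebesgue_measure]_x (expR (- (2^-1 * qform S (x%:M - c))))%:E =
   (Num.sqrt (2 * pi / \det S))%:E)%E.
Proof.
move=> [_ Sp].
have d0 : 0 < \det S.
  have := Sp 1%:M; rewrite /qform trmx1 mulmx1 mul1mx det_mx11; apply.
  by rewrite oner_eq0.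
(* In dimension 1, [\det S] is the single entry of [S], the inverse variance, so [s] is the standard
   deviation. *)
set s := (Num.sqrt (\det S))^-1.
have s2 : s ^+ 2 = (\det S)^-1 by rewrite exprVn sqr_sqrtr// ltW.
have s0 : s != 0 by rewrite invr_eq0 gt_eqF// sqrtr_gt0.
split=> //; rewrite (_ : Num.sqrt _ = (normal_peak s)^-1); last first.
  by rewrite /normal_peak invrK s2 -mulr_natl; congr Num.sqrt; ring.
rewrite -(integral_normal_fun R (c ord0 ord0))//.
apply: eq_integral => x _; congr (expR _)%:E.
have a0 : S ord0 ord0 != 0 by rewrite -det_mx11 gt_eqF.
rewrite s2 /qform det_mx11 !(mxE, big_ord_recl, big_ord0) /= mulr1n.
move: (S ord0 ord0) (c ord0 ord0) a0 => a b a0.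
by rewrite -mulr_natr; field.
Qed.

Lemma ge0_integral_lebesgue_tupleS (R : realType) (n : nat)
    (f : n.+1.-tuple (measurableTypeR R) -> \bar R) :
  measurable_fun setT f -> (forall t, 0 <= f t)%E ->
  (\int[lebesgue_tuple R n.+1]_(t in setT) f t =
   \int[lebesgue_measure]_x \int[lebesgue_tuple R n]_t f (cons_pair (x, t)))%E.
Proof.
move=> mf f0.
(* Holds by unfolding: Lebesgue measure in dimension [n.+1] is defined as this pushforward. *)
transitivity (\int[pushforward (lebesgue_measure \x lebesgue_tuple R n)%E
   (@cons_pair R n)]_(t in setT) f t)%E; first by [].
rewrite ge0_integral_pushforward//; last exact: measurable_cons_pair.
rewrite preimage_setT fubini_tonelli1//; last by move=> p; exact: f0.
by apply: (measurable_comp measurableT _ mf) => //; exact: measurable_cons_pair.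
Qed.

(** Positivity of the determinant is carried through the same induction, since both claims rest on
    [\det A = \det S * \det D]. The centre [c] is generalized because the inner integral is centred
    at a point that moves with the first coordinate. *)
Lemma integral_gaussian_exp (R : realType) (n : nat) (A : 'M[R]_n) (c : 'cV[R]_n) :
  posdefmx A -> 0 < \det A /\
  (\int[lebesgue_tuple R n]_(t in setT)
     (expR (- (2^-1 * qform A (col_of_tuple t - c))))%:E =
   (Num.sqrt ((2 * pi) ^+ n / \det A))%:E)%E.
Proof.
elim: n A c => [|n IH] A c Apd.
  rewrite det_mx00; split=> //.
  rewrite integral_dirac//; last first.
    by apply/measurable_EFinP; apply: measurable_gaussian_exp; exact: measurable_col_of_tupleB.
  rewrite diracT mul1e (flatmx0 (_ - _)) qform0 mulr0 oppr0 expR0.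
  by rewrite expr0 divr1 sqrtr1.
have [S [D [g [Spd Dpd dE qE]]]] := @posdefmx_schur R 1 n A Apd.
pose c1 : 'cV_1 := @usubmx R 1 n 1 c; pose c2 : 'cV_n := @dsubmx R 1 n 1 c.
have [dS IS] := integral_gaussian_exp1 R S c1 Spd.
have [dD _] := IH D 0 Dpd.
split; first by rewrite dE mulr_gt0.
have mf : measurable_fun setT (fun t : n.+1.-tuple (measurableTypeR R) =>
   (expR (- (2^-1 * qform A (col_of_tuple t - c))))%:E).
  by apply/measurable_EFinP; apply: measurable_gaussian_exp; exact: measurable_col_of_tupleB.
have f0 t : (0 <= (expR (- (2^-1 * qform A (col_of_tuple t - c))))%:E)%E.
  by rewrite lee_fin expR_ge0.
rewrite ge0_integral_lebesgue_tupleS//.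
transitivity (\int[lebesgue_measure]_x
   (expR (- (2^-1 * qform S (x%:M - c1))) *
    Num.sqrt ((2 * pi) ^+ n / \det D))%:E)%E.
  apply: eq_integral => x _.
  (* Chosen so that [t - c'] equals [(t - c2) + g *m (x - c1)], the argument of [D] in the Schur
     splitting. The inner integral does not depend on its centre, hence not on [x]. *)
  pose c' := c2 - g *m (x%:M - c1).
  rewrite EFinM -(IH D c' Dpd).2 -ge0_integralZl//; last first.
    by apply/measurable_EFinP; apply: measurable_gaussian_exp; exact: measurable_col_of_tupleB.
  apply: eq_integral => t _.
  rewrite -EFinM -expRD; congr (expR _)%:E.
  have -> : col_of_tuple (cons_pair (x, t)) - c =
      col_mx (x%:M - c1) (col_of_tuple t - c2) :> 'cV_(1 + n).
    apply/matrixP => i j; rewrite !mxE.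
    case: splitP => k ik; rewrite !mxE (ord1 j).
      rewrite (ord1 k) eqxx mulr1n.
      have -> : i = lshift n ord0 by apply/val_inj; rewrite /= ik (ord1 k).
      by [].
    have -> : i = rshift 1 k by exact/val_inj.
    have -> : rshift 1 k = lift ord0 k by exact/val_inj.
    by rewrite tnthS.
  rewrite qE mulrDr opprD; congr (- _ + - (_ * qform D _)).
  by rewrite /c' opprB addrA [RHS]addrAC.
under eq_integral do rewrite EFinM.
rewrite ge0_integralZr//; last first.
- apply/measurable_EFinP; apply: measurable_gaussian_exp => i.
  rewrite (_ : (fun _ => _) = (fun x => x - c1 ord0 ord0)); last first.
    by apply/funext => x; rewrite (ord1 i) !mxE.
  exact: measurable_funB.
rewrite IS -EFinM -sqrtrM; last by rewrite divr_ge0 ?mulr_ge0 ?pi_ge0// ltW.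
congr (Num.sqrt _)%:E; rewrite dE exprS.
by field; rewrite !gt_eqF.
Qed.

(** * The Gaussian density and uniqueness of normalization *)

Lemma gaussian_pdf_normalizer_gt0 (R : realType) (n : nat) (Sigma : 'M[R]_n) :
  posdefmx Sigma -> 0 < Num.sqrt ((2 * pi) ^+ n * \det Sigma).
Proof.
move=> Spd; have [dS _] := integral_gaussian_exp R n Sigma 0 Spd.
by rewrite sqrtr_gt0 mulr_gt0// exprn_gt0// mulr_gt0// pi_gt0.
Qed.

Lemma is_pdf_gaussian (R : realType) (n : nat) (mu : 'cV[R]_n) (Sigma : 'M[R]_n) :
  posdefmx Sigma -> is_pdf (gaussian_pdf mu Sigma).
Proof.
move=> Spd; have N0 := gaussian_pdf_normalizer_gt0 _ _ _ Spd.
have me : measurable_fun setT (fun t : n.-tuple (measurableTypeR R) =>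
    expR (- (2^-1 * qform (invmx Sigma) (col_of_tuple t - mu)))).
  by apply: measurable_gaussian_exp; exact: measurable_col_of_tupleB.
split.
- exact: measurable_funM.
- by move=> x; rewrite mulr_ge0 ?expR_ge0// invr_ge0 ltW.
- under eq_integral do rewrite EFinM.
  have N1 : (0 <= ((Num.sqrt ((2 * pi) ^+ n * \det Sigma))^-1)%:E)%E.
    by rewrite lee_fin invr_ge0 ltW.
  rewrite ge0_integralZl//; last exact/measurable_EFinP.
  rewrite (integral_gaussian_exp _ _ _ _ (posdefmx_inv _ _ _ Spd)).2.
  by rewrite det_inv invrK -EFinM mulVf// gt_eqF.
Qed.

(** Integrating [p = c * q] gives [1 = c]; [q] is integrable because it is nonnegative with integral
    1. *)
Lemma is_pdf_proportional_eq (R : realType) (n : nat) (p q : 'cV[R]_n -> R) :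
  is_pdf p -> is_pdf q -> proportional p q -> p = q.
Proof.
move=> [_ _ p1] [mq q0 q1] [c pE].
suff c1 : c = 1 by apply/funext => x; rewrite pE c1 mul1r.
have := p1; under eq_integral do rewrite pE EFinM.
rewrite integralZl//; first by rewrite q1 mule1 => -[].
apply/integrableP; split; first exact/measurable_EFinP.
under eq_integral do rewrite /= ger0_norm ?q0//.
by rewrite q1 ltry.
Qed.

(** * Completing the square in the cost, and the update formulas *)

(* [Lambda *m (mu - mubar)] is the linear part of the cost, so the gradient of
   the cost vanishes at [mu]. *)
Lemma ekf_cost_complete_square (R : realType) (n m : nat) (mubar muO : 'cV[R]_n)
    (z zhat : 'cV[R]_m) (H : 'M[R]_(m, n)) (Sbar SO : 'M[R]_n) (Q : 'M[R]_m)
    (mu x : 'cV[R]_n) :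
  let Lambda := H^T *m invmx Q *m H + invmx SO + invmx Sbar in
  posdefmx Sbar -> posdefmx SO -> posdefmx Q ->
  Lambda *m (mu - mubar) =
    H^T *m invmx Q *m (z - zhat) + invmx SO *m (muO - mubar) ->
  ekf_cost mubar muO z zhat H Sbar SO Q x =
  ekf_cost mubar muO z zhat H Sbar SO Q mu + 2^-1 * qform Lambda (x - mu).
Proof.
move=> Lambda /posdefmx_inv/posdefmx_sym Ss /posdefmx_inv/posdefmx_sym Os
  /posdefmx_inv/posdefmx_sym Qs; rewrite /Lambda /ekf_cost.
set w := x - mu; set d := mu - mubar; set r := z - zhat; set o := muO - mubar => dE.
have xE : x - mubar = d + w by rewrite [RHS]addrC subrKA.
have -> : r - H *m (x - mubar) = (r - H *m d) + - (H *m w).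
  by rewrite xE mulmxDr opprD addrA.
have -> : x - muO = (mu - muO) + w by rewrite [RHS]addrC subrKA.
have -> : mu - muO = d - o by rewrite opprB addrA subrK.
rewrite xE; move: w d r o dE {xE} => w d r o dE.
rewrite (qformD _ _ _ (r - H *m d) _ Qs) (qformD _ _ _ (d - o) w Os).
rewrite (qformD _ _ _ d w Ss) !qformDl qform_congr qformN.
(* Expanding the three forms around [mu] leaves, besides the constant and the second order part,
   twice these cross terms: their sum is the gradient at [mu] paired with [w]. *)
suff : ((r - H *m d)^T *m invmx Q *m (- (H *m w))) ord0 ord0 +
    ((d - o)^T *m invmx SO *m w) ord0 ord0 +
    (d^T *m invmx Sbar *m w) ord0 ord0 = 0 by lra.
rewrite -!mx11D mulmxN mulmxA -mulNmx -!mulmxDl.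
rewrite (_ : _ + _ = 0) ?mul0mx ?mxE//.
(* The row vector multiplying [w] is transposed to match the column equation [dE]. *)
apply/trmx_inj; rewrite trmx0 !linearD/= !linearN/= !trmx_mul.
rewrite !linearD/= !linearN/= !trmx_mul !trmxK Ss Os Qs.
move: dE; rewrite /Lambda !mulmxDl => /eqP; rewrite -subr_eq0 => /eqP <-.
rewrite !mulmxA.
move: (_ *m r) (_ *m o) (_ *m H *m d) (invmx SO *m d) (invmx Sbar *m d).
move=> a b e f g.
by apply/matrixP => i j; rewrite !mxE; ring.
Qed.

(** Rests on the factorization of [invmx B + invmx A] as [invmx B *m (A + B) *m invmx A]. *)
Lemma parallel_sum_inv (R : realType) (n : nat) (A B : 'M[R]_n) :
  posdefmx A -> posdefmx B ->
  A *m invmx (A + B) *m B = invmx (invmx B + invmx A).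
Proof.
move=> Apd Bpd; have ABu := posdefmx_unit _ _ _ (posdefmxD _ _ _ _ Apd Bpd).
have Au := posdefmx_unit _ _ _ Apd; have Bu := posdefmx_unit _ _ _ Bpd.
have IBAu : invmx B + invmx A \in unitmx.
  by apply/posdefmx_unit/posdefmxD; exact: posdefmx_inv.
rewrite -[LHS](mulmxK IBAu) -[RHS]mul1mx; congr (_ *m _).
have -> : invmx B + invmx A = invmx B *m (A + B) *m invmx A.
  by rewrite mulmxDr mulmxDl mulmxK// mulVmx// mul1mx.
by rewrite !mulmxA mulmxK// mulmxKV// mulmxV.
Qed.

Theorem mainTheorem1 (R : realType) (n m : nat)
    (n_ge1 : (1 <= n)%N) (m_ge1 : (1 <= m)%N)
    (mubar muO : 'cV[R]_n) (z zhat : 'cV[R]_m) (H : 'M[R]_(m, n))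
    (Sbar SO : 'M[R]_n) (Q : 'M[R]_m)
    (Sbar_pd : posdefmx Sbar) (SO_pd : posdefmx SO) (Q_pd : posdefmx Q) :
  let J := ekf_cost mubar muO z zhat H Sbar SO Q in
  let Lambda := H^T *m invmx Q *m H + invmx SO + invmx Sbar in
  let Sigma := invmx Lambda in
  let K := Sigma *m H^T *m invmx Q in
  let mu := mubar + K *m (z - zhat) + Sigma *m invmx SO *m (muO - mubar) in
  let P := Sbar *m invmx (Sbar + SO) *m SO in
  (* the inverses exist and Sigma is a covariance matrix *)
  [/\ Lambda \in unitmx, Sbar + SO \in unitmx,
      H *m P *m H^T + Q \in unitmx & posdefmx Sigma] /\
  [/\ (* the density proportional to exp(-J) exists, is unique, and is N(mu, Sigma) *)
      forall p : 'cV[R]_n -> R,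
        is_pdf p /\ proportional p (fun x => expR (- J x)) <->
        p = gaussian_pdf mu Sigma,
      K = P *m H^T *m invmx (H *m P *m H^T + Q) &
      Sigma = (1%:M - K *m H) *m P].
Proof.
move=> J Lambda Sigma K mu P.
have [iSbar iSO] := (posdefmx_inv _ _ _ Sbar_pd, posdefmx_inv _ _ _ SO_pd).
have iQ := posdefmx_inv _ _ _ Q_pd.
have Lpd : posdefmx Lambda by apply: posdefmxD => //; exact: posdefmxD_congr.
have Lu := posdefmx_unit _ _ _ Lpd.
have Sigma_pd : posdefmx Sigma by exact: posdefmx_inv.
have iPpd : posdefmx (invmx SO + invmx Sbar) by exact: posdefmxD.
have PE : P = invmx (invmx SO + invmx Sbar) by exact: parallel_sum_inv.
have Ppd : posdefmx P by rewrite PE; exact: posdefmx_inv.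
have LE : Lambda = H^T *m invmx Q *m H + invmx P by rewrite PE invmxK addrA.
have Pu := posdefmx_unit _ _ _ Ppd.
have Spd : posdefmx (H *m P *m H^T + Q).
  (* Writing [H] as a double transpose exhibits [H *m P *m H^T] as a congruence by [H^T]. *)
  by rewrite -{1}(trmxK H); exact: posdefmxD_congr.
have Su := posdefmx_unit _ _ _ Spd.
split; first by split=> //; exact/posdefmx_unit/posdefmxD.
have KHP : K *m H *m P = P - Sigma.
  have -> : K *m H = Sigma *m (Lambda - invmx P).
    by rewrite LE addrK !mulmxA.
  by rewrite mulmxBr mulVmx// mulmxBl mul1mx mulmxKV.
(* The first summand gives [(P - Sigma) *m H^T] by [KHP], and [K *m Q = Sigma *m H^T] restores the
   missing part. *)
have KE : K *m (H *m P *m H^T + Q) = P *m H^T.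
  rewrite mulmxDr mulmxA [K *m (H *m P)]mulmxA KHP.
  by rewrite mulmxBl mulmxKV ?subrK// posdefmx_unit.
split.
- have muE : Lambda *m (mu - mubar) =
      H^T *m invmx Q *m (z - zhat) + invmx SO *m (muO - mubar).
    have -> : mu - mubar = K *m (z - zhat) + Sigma *m invmx SO *m (muO - mubar).
      rewrite /mu; move: (K *m _) (_ *m (muO - _)) => a b.
      by rewrite -[mubar + _ + _]addrA [LHS]addrC addKr.
    rewrite mulmxDr /K !mulmxA.
    by rewrite mulmxV// !mul1mx.
  have JE x := ekf_cost_complete_square R n m mubar muO z zhat H Sbar SO Q mu x
    Sbar_pd SO_pd Q_pd muE.
  have N0 := gaussian_pdf_normalizer_gt0 _ _ _ Sigma_pd.
  set N := Num.sqrt _ in N0.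
  (* The factor [expR (- J mu) * N] is positive, so being proportional to [exp(-J)] and being
     proportional to the Gaussian density are interchangeable. *)
  have expE x : expR (- J x) = expR (- J mu) * N * gaussian_pdf mu Sigma x.
    rewrite /J JE opprD expRD /gaussian_pdf -/N invmxK -mulrA mulVKf//.
    by rewrite gt_eqF.
  have g1 := is_pdf_gaussian R n mu Sigma Sigma_pd.
  move=> p; split=> [[p1 [c pE]]|->].
    apply: is_pdf_proportional_eq => //.
    exists (c * (expR (- J mu) * N)) => x.
    by rewrite pE expE mulrA.
  split=> //; exists (expR (- J mu) * N)^-1 => x.
  by rewrite (expE x) mulKf// mulf_neq0// gt_eqF// expR_gt0.
- by rewrite -KE mulmxK.
- rewrite mulmxBl mul1mx.
  by rewrite KHP opprB addrC subrK.
Qed.
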